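(* Fix $\lambda\in\mathbb R$. There is $C=C(\lambda)<\infty$ such that, for $0<\varepsilon\le1$, $$\sup_{n\ge n_\lambda}\mathbb E\sum_{i:X_{n,i}\le\varepsilon}X_{n,i}^2\le C\sqrt\varepsilon .$$ For every $0<a<b<\infty$, $$\lim_{R\to\infty}\sup_{n\ge n_\lambda}\mathbb E\,\Xi_n\bigl([a,b]\times\{R+1,R+2,\dots\}\bigr)=0 .$$
   Context: Put $p_n=n^{-1}+\lambda n^{-4/3}$ and let $n_\lambda$ be a fixed integer with $p_n\in(0,1)$ for all $n\ge n_\lambda$. $G(n,p)$ is the Erdős–Rényi random graph, $\mathcal C(G)$ the set of connected components of $G$; for a component $C$, $|C|$ and $e(C)$ are its numbers of vertices and edges, and $\operatorname{sp}(C)=e(C)-|C|+1$. Let $C_{n,1},C_{n,2},\dots$ be the components of $G(n,p_n)$ in nonincreasing order of size (ties broken arbitrarily) and $X_{n,i}=n^{-2/3}|C_{n,i}|$, with $X_{n,i}=0$ when $i$ exceeds the number of components. $\Xi_n=\sum_{C\in\mathcal C(G(n,p_n))}\delta_{(n^{-2/3}|C|,\operatorname{sp}(C))}$ is a point process on $(0,\infty)\times\mathbb Z_{\ge0}$. *)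

(* Defs.v *)
From HB Require Import structures.
From mathcomp Require Import all_boot all_order all_algebra.
From mathcomp Require Import all_classical all_reals all_analysis.

Set Implicit Arguments.
Unset Strict Implicit.
Unset Printing Implicit Defensive.

Import Order.TTheory GRing.Theory Num.Theory.
Import numFieldNormedType.Exports.

Local Open Scope classical_set_scope.
Local Open Scope ring_scope.

Section Graph.
Variable n : nat.

(* A simple graph on the vertex set 'I_n is given by its set of edges, that
   is, by a subset of [vpairs]. *)
Definition vpairs : {set {set 'I_n}} := [set e : {set 'I_n} | #|e| == 2%N]%SET.

Definition graphs : {set {set {set 'I_n}}} := powerset vpairs.

Implicit Types (G : {set {set 'I_n}}) (C : {set 'I_n}).

Definition adj G : rel 'I_n := fun x y => [set x; y]%SET \in G.

Definition components G : {set {set 'I_n}} :=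
  equivalence_partition (connect (adj G)) [set: 'I_n]%SET.

Definition nedges G C : nat := #|[set e in G | e \subset C]%SET|.

(* sp(C) = e(C) - |C| + 1; the truncated subtraction is exact because a
   connected C has at least |C| - 1 edges. *)
Definition surplus G C : nat := ((nedges G C).+1 - #|C|)%N.

Definition ranked_components G : seq {set 'I_n} :=
  sort (fun C D : {set 'I_n} => (#|D| <= #|C|)%N) (enum (components G)).

(* C_{n,i}, with i starting at 1; it is empty when i exceeds the number of
   components. *)
Definition ranked_component G (i : nat) : {set 'I_n} :=
  nth finset.set0 (ranked_components G) i.-1.

End Graph.

Section RandomGraph.
Variable R : realType.

(* Expectation under G(n,p): each pair is an edge with probability p,
   independently of the others. *)
Definition ER_weight (n : nat) (p : R) (G : {set {set 'I_n}}) : R :=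
  \prod_(e in vpairs n) (if e \in G then p else 1 - p).

Definition ER_expectation (n : nat) (p : R) (f : {set {set 'I_n}} -> \bar R)
    : \bar R :=
  (\sum_(G in graphs n) (ER_weight p G)%:E * f G)%E.

Definition critical_p (lam : R) (n : nat) : R :=
  n%:R^-1 + lam * n%:R `^ (- (4 / 3)).

Definition rescaled_size (n : nat) (C : {set 'I_n}) : R :=
  n%:R `^ (- (2 / 3)) * #|C|%:R.

Definition Xn (n : nat) (G : {set {set 'I_n}}) (i : nat) : R :=
  rescaled_size (ranked_component G i).

Definition Xi (n : nat) (G : {set {set 'I_n}}) (A : set (R * nat)) : \bar R :=
  (\sum_(C in components G) \d_(rescaled_size C, surplus G C) A)%E.

End RandomGraph.

(* Main.v *)
Require Import Defs.
From HB Require Import structures.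
From mathcomp Require Import all_boot all_order all_algebra.
From mathcomp Require Import all_classical all_reals all_analysis.
From mathcomp Require Import ring lra zify.

Set Implicit Arguments.
Unset Strict Implicit.
Unset Printing Implicit Defensive.

Import Order.TTheory GRing.Theory Num.Theory.
Import numFieldNormedType.Exports.

Local Open Scope classical_set_scope.
Local Open Scope ring_scope.

(** Both parts reduce to one vertex: a sum over components weighted by the
    size is a sum over vertices v of a function of the component C(v)
    ([sum_components]).  So part one asks for E[|C(v)|; |C(v)| <= K] = O(sqrt K)
    with K = eps n^(2/3), and part two, by Markov's inequality for the surplus
    sp(v) of C(v), for E[sp(v); |C(v)| <= K] = O(K/n) with K of order n^(2/3).
    In both, the constraint |C(v)| <= K is replaced by a weight s^|C(v)|, that
    is, each vertex is killed with probability 1 - s of order 1/K; write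
    s = 1 / (1 + theta^2), so that theta is of order K^(-1/2).

    Exploring C(v) vertex by vertex, the number j of active vertices performs a
    random walk whose steps are at most Bin(n, p) - 1, so expectations are
    bounded by any supersolution of a recursion in j ([perc_explore]).  The
    exploration is run one edge at a time inside an arbitrary graph H of
    potential edges: if v lies in the set A and the edge vu is revealed, the
    exploration continues in H - vu, from A if vu is absent and from A and u if
    it is present.  An induction on H then does without any conditioning.

    Let phi be at most its image s (1 - p + p phi)^n under the generating
    function of a killed step.  Then E s^|C(v)| >= phi ([perc_size_le]), and
    near criticality the curvature of the generating function gives such a phi
    with 1 - phi = O(theta) ([extinction_bound]).  Part one follows from
    k <= 2 K (1 - s^k) for k <= K.

    For the surplus, each processed vertex closes at most p (j - 1) cycles in
    expectation, so the total is p times the area below the walk.  A linear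
    function of j is almost a supersolution; the drift L theta of the walk
    costs a further multiple of 1 - phi^j, which gains 1 - s at every step.
    With 1 - phi = O(theta) this yields E[s^|C(v)| sp(v)] = O(p / theta^2)
    ([perc_excess_le]), as wanted. *)

(** * Reachability and excess *)

Section Reach.
(* Finite and classical sets share many names, such as subsetP and set0; in
   this section they refer to finite sets. *)
Import boot.fintype boot.finset.
Variable n : nat.
Implicit Types (G H : {set {set 'I_n}}) (A S : {set 'I_n}) (u v x y : 'I_n).

Definition reach G A : {set 'I_n} :=
  [set y | [exists x in A, connect (adj G) x y]]%SET.

Lemma sub_reach G A : A \subset reach G A.
Proof.
apply/subsetP => x Ax; rewrite inE; apply/existsP; exists x.
by rewrite Ax connect0.
Qed.

Lemma reach_adj G A x y : x \in reach G A -> adj G x y -> y \in reach G A.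
Proof.
rewrite !inE => /existsP[z /andP[Az zx]] xy; apply/existsP; exists z.
by rewrite Az (connect_trans zx)// connect1.
Qed.

Lemma reach_min G A S : A \subset S ->
  (forall x y, x \in S -> adj G x y -> y \in S) -> reach G A \subset S.
Proof.
move=> /subsetP AS Sadj; apply/subsetP => y; rewrite inE.
move=> /existsP[x /andP[/AS Sx /connectP[q xq ->]]].
elim: q x Sx xq => //= z q IHq x Sx /andP[xz zq].
exact: IHq (Sadj _ _ Sx xz) zq.
Qed.

Lemma reach0 G : reach G set0 = set0.
Proof.
by apply/eqP; rewrite -subset0; apply: reach_min => // x y; rewrite inE.
Qed.

(** The step of the exploration: once one end v of a new edge has been reached,
    the edge acts exactly as if its other end u had been a starting point. *)
Lemma reach_add_edge G A u v : v \in A ->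
  reach ([set v; u] |: G)%SET A = reach G (u |: A)%SET.
Proof.
move=> Av; apply/eqP; rewrite eqEsubset; apply/andP; split.
  apply: reach_min.
    exact: subset_trans (subsetUr _ _) (sub_reach _ _).
  move=> x y Sx; rewrite /adj in_setU1 => /orP[/eqP xy|xyG]; last first.
    exact: reach_adj Sx xyG.
  have : y \in [set v; u]%SET by rewrite -xy set22.
  rewrite in_set2 => /orP[]/eqP ->; apply: (subsetP (sub_reach _ _)).
    by rewrite in_setU1 Av orbT.
  exact: setU11.
apply: reach_min.
  apply/subsetP => x; rewrite in_setU1 => /orP[/eqP ->|Ax].
    apply: (@reach_adj _ _ v); first exact: (subsetP (sub_reach _ _)).
    by rewrite /adj setU11.
  exact: (subsetP (sub_reach _ _)).
move=> x y Sx xy; apply: reach_adj Sx _.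
by rewrite /adj in_setU1 [_ \in G]xy orbT.
Qed.

(** A vertex all of whose edges have been revealed can be dropped from the set
    of starting points; it then counts for itself only. *)
Lemma reach_isolated G A v : v \in A -> (forall e, e \in G -> v \notin e) ->
  reach G A = (v |: reach G (A :\ v))%SET /\ v \notin reach G (A :\ v)%SET.
Proof.
move=> Av Gv; split.
  apply/eqP; rewrite eqEsubset; apply/andP; split.
    apply: reach_min.
      rewrite -{1}(setD1K Av); apply: setUS; exact: sub_reach.
    move=> x y; rewrite in_setU1 => /orP[/eqP-> /Gv|Sx xy].
      by rewrite set21.
    by rewrite in_setU1 (reach_adj Sx xy) orbT.
  rewrite subUset sub1set (subsetP (sub_reach _ _))//=.
  apply: reach_min; last by move=> x y; exact: reach_adj.
  exact: subset_trans (subD1set _ _) (sub_reach _ _).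
have /subsetP sub : reach G (A :\ v)%SET \subset [set~ v]%SET.
  apply: reach_min; first by apply/subsetP => x; rewrite !inE => /andP[].
  move=> x y _ /Gv; rewrite !inE => /norP[_]; by rewrite eq_sym.
by apply/negP => /sub; rewrite !inE eqxx.
Qed.

(** For A = {v} this is the surplus of the component of v.  In general it is
    the number of independent cycles that appear once A is contracted to a
    point, so it still counts the cycles left to be closed when the exploration
    has already reached A. *)
Definition excess G A : nat := (nedges G (reach G A) + #|A| - #|reach G A|)%N.

Lemma excess0 G : G \subset vpairs n -> excess G set0 = 0%N.
Proof.
move=> /subsetP GE; rewrite /excess reach0 cards0 addn0 subn0; apply/eqP.
rewrite cards_eq0; apply/eqP/setP => e; rewrite !inE.
apply/negP => /andP[/GE]; rewrite inE subset0 => /eqP e2 /eqP e0.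
by rewrite e0 cards0 in e2.
Qed.

(** An edge to a vertex already reached closes one cycle; an edge to a new
    vertex u closes none, because the additional edge is offset by the
    additional starting point. *)
Lemma excess_add_edge G A u v : v \in A -> [set v; u]%SET \notin G ->
  (excess ([set v; u] |: G)%SET A <= excess G (u |: A)%SET + (u \in A))%N.
Proof.
move=> Av eG; rewrite /excess reach_add_edge// cardsU1.
set S := reach _ _.
have -> : nedges ([set v; u] |: G)%SET S = (nedges G S).+1.
  rewrite /nedges.
  have -> : [set e in [set v; u] |: G | e \subset S]%SET
            = ([set v; u] |: [set e in G | e \subset S])%SET.
    apply/setP => e; rewrite !inE; case: eqP => //= ->.
    apply/subsetP => x; rewrite in_set2 => xvu.
    apply: (subsetP (sub_reach _ _)).
    by move: xvu => /orP[]/eqP->; rewrite in_setU1 ?eqxx ?Av ?orbT.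
  by rewrite cardsU1 inE (negPf eG).
by case: (u \in A) => /=; lia.
Qed.

Lemma excess_isolated G A v : v \in A -> (forall e, e \in G -> v \notin e) ->
  excess G A = excess G (A :\ v)%SET.
Proof.
move=> Av Gv; have [rE vr] := reach_isolated Av Gv.
rewrite /excess rE cardsU1 vr (cardsD1 v A) Av.
have -> : nedges G (v |: reach G (A :\ v))%SET = nedges G (reach G (A :\ v)%SET).
  apply: eq_card => e; rewrite !inE; case: (boolP (e \in G)) => //= /Gv ve.
  apply/idP/idP => [|h]; last exact: subset_trans h (subsetUr _ _).
  move=> /subsetP h; apply/subsetP => x ex; move: (h x ex); rewrite in_setU1.
  by case: eqP => // xv; move: ve; rewrite -xv ex.
by rewrite /= add1n add1n addnS subSS.
Qed.

Lemma connect_adjC G : connect_sym (adj G).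
Proof. by apply: sym_connect_sym => x y; rewrite /adj setUC. Qed.

Lemma components_partition G : partition (components G) [set: 'I_n]%SET.
Proof.
apply: equivalence_partitionP => x y z _ _ _; split; first exact: connect0.
move=> xy; apply/idP/idP; last exact: connect_trans.
by apply: connect_trans; rewrite connect_adjC.
Qed.

Lemma component_reach G C x : C \in components G -> x \in C ->
  C = reach G [set x]%SET.
Proof.
case/imsetP => y _ ->; rewrite !inE /= => yx.
apply/setP => z; rewrite !inE /=; apply/idP/idP.
  move=> yz; apply/existsP; exists x; rewrite set11.
  by apply: connect_trans yz; rewrite connect_adjC.
move=> /existsP[w /andP[]]; rewrite in_set1 => /eqP ->.
exact: connect_trans.
Qed.

Lemma surplus_excess G x : surplus G (reach G [set x]%SET) = excess G [set x]%SET.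
Proof. by rewrite /surplus /excess cards1 addn1. Qed.

End Reach.

(** * Percolation on a finite set of edges *)

Section Percolation.
Import boot.fintype boot.finset.
Variables (R : realDomainType) (T : finType) (p : R).
Implicit Types (G H : {set T}) (f g : {set T} -> R).

(** Bernoulli percolation with an arbitrary set H of potential edges; keeping H
    arbitrary is what makes inductions that reveal one edge possible. *)
Definition perc H f : R :=
  \sum_(G in powerset H) (\prod_(e in H) (if e \in G then p else 1 - p)) * f G.

(** Conditioning on the state of one edge. *)
Lemma perc_split H f e : e \in H ->
  perc H f = p * perc (H :\ e)%SET (fun G => f (e |: G)%SET)
             + (1 - p) * perc (H :\ e)%SET f.
Proof.
move=> eH; rewrite /perc (bigID (fun G : {set T} => e \in G)) /=; congr (_ + _).
  rewrite (reindex_onto (fun G => (e |: G)%SET)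
    (fun G => (G :\ e)%SET)) /=; last first.
    by move=> G /andP[_ eG]; rewrite setD1K.
  rewrite mulr_sumr; apply: eq_big => [G|G].
    rewrite !powersetE setU11 andbT subUset sub1set eH /= subsetD1.
    have [eG|eG] := boolP (e \in G); last by rewrite setU1K// eqxx.
    rewrite !andbF; apply/andP => -[_ /eqP GE].
    by move: eG; rewrite -GE !inE eqxx.
  move=> /andP[_ /eqP eG]; rewrite mulrA; congr (_ * _).
  rewrite (big_setD1 e)//= setU11; congr (_ * _); apply: eq_bigr => i.
  by rewrite !inE => /andP[/negPf ->].
rewrite mulr_sumr; apply: eq_big => [G|G].
  by rewrite !powersetE subsetD1.
move=> /andP[_ /negPf eG]; rewrite mulrA; congr (_ * _).
by rewrite (big_setD1 e)//= eG.
Qed.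

Hypothesis p01 : 0 <= p <= 1.

Lemma le_perc H f g : (forall G, G \subset H -> f G <= g G) ->
  perc H f <= perc H g.
Proof.
move: p01 => /andP[p0 p1] fg; apply: ler_sum => G; rewrite powersetE => GH.
apply: ler_wpM2l; last exact: fg.
by apply: prodr_ge0 => e _; case: ifP => // _; rewrite subr_ge0.
Qed.

Lemma percD H f g : perc H (fun G => f G + g G) = perc H f + perc H g.
Proof. by rewrite /perc -big_split; apply: eq_bigr => G _; rewrite /= mulrDr. Qed.

Lemma percZ H f c : perc H (fun G => c * f G) = c * perc H f.
Proof. by rewrite /perc mulr_sumr; apply: eq_bigr => G _; rewrite mulrCA. Qed.

Lemma perc_cst H c : perc H (fun=> c) = c.
Proof.
elim: {H}#|H| {-2}H (erefl #|H|) => [|m IHm] H.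
  move=> /cards0_eq ->; rewrite /perc powerset0 big_set1 big_set0.
  by rewrite mul1r.
move=> Hm; have /card_gt0P[e eH] : (0 < #|H|)%N by rewrite Hm.
rewrite (perc_split _ eH) IHm; first by ring.
by apply: succn_inj; rewrite -Hm (cardsD1 e H) eH.
Qed.

Lemma perc_sum H (I : finType) (F : I -> {set T} -> R) :
  perc H (fun G => \sum_i F i G) = \sum_i perc H (F i).
Proof.
rewrite /perc exchange_big; apply: eq_bigr => G _ /=.
by rewrite mulr_sumr.
Qed.

End Percolation.

(** * Exploration one edge at a time *)

Section Exploration.
Import boot.fintype boot.finset.
Variables (R : realDomainType) (n : nat) (p : R).
Hypothesis p01 : 0 <= p <= 1.
Implicit Types (G H : {set {set 'I_n}}) (A : {set 'I_n}) (u v : 'I_n).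

Definition nbhd_in H v A : {set 'I_n} := [set u in A | [set v; u] \in H]%SET.

(* F A G is a functional of the exploration of G started from A.  Closing a
   cycle costs at most c, finishing a vertex costs b and multiplies the rest by
   s.  The supersolution D d j bounds the future cost when there are j active
   vertices and, in addition, d undecided edges from the vertex in progress to
   unexplored vertices. *)
Variables (F : {set 'I_n} -> {set {set 'I_n}} -> R) (D : nat -> nat -> R).
Variables (s b c : R).
Hypothesis s0 : 0 <= s.
Hypothesis c0 : 0 <= c.
Hypothesis F_set0 : forall G, G \subset vpairs n -> F set0 G <= D 0 0.
Hypothesis F_edge : forall G A u v, v \in A -> [set v; u]%SET \notin G ->
  F A ([set v; u] |: G)%SET <= F (u |: A)%SET G + c *+ (u \in A).
Hypothesis F_vertex : forall G A v, v \in A ->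
  (forall e, e \in G -> v \notin e) -> F A G <= b + s * F (A :\ v)%SET G.
Hypothesis D_edge : forall d j,
  p * D d j.+1 + (1 - p) * D d j <= D d.+1 j.
Hypothesis D_vertex : forall d j, (d <= n)%N ->
  b + p * c *+ j + s * D d j <= D 0 j.+1.

Lemma set2_inj v u w : u != v -> [set v; u]%SET = [set v; w]%SET -> u = w.
Proof.
move=> uv E; have : u \in [set v; w]%SET by rewrite -E set22.
by rewrite in_set2 (negPf uv) => /eqP.
Qed.

Lemma nbhd_in_split H v u A : u != v -> [set v; u]%SET \in H ->
  #|nbhd_in H v A| = ((u \in A) + #|nbhd_in (H :\ [set v; u])%SET v A|)%N.
Proof.
move=> uv eH; rewrite (cardsD1 u) !inE eH andbT; congr (_ + _)%N.
apply: eq_card => w; rewrite !inE.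
case: (eqVneq w u) => [->|wu] /=; first by rewrite eqxx !andbF.
have -> //: [set v; w]%SET != [set v; u]%SET.
by apply: contra_neq wu => /esym/(set2_inj uv).
Qed.

Lemma vpairsP v e : e \in vpairs n -> v \in e ->
  exists2 u, u != v & e = [set v; u]%SET.
Proof.
rewrite inE => /cards2P[x [y [xy ->]]]; rewrite in_set2 => /orP[]/eqP ->.
  by exists y => //; rewrite eq_sym.
by exists x => //; rewrite finset.setUC.
Qed.

(* The bound while the active vertex v is in progress: its undecided edges into
   A may still close cycles, those leaving A may still produce new active
   vertices, and v itself is no longer counted as active. *)
Let explored H A v :=
  b + p * c *+ #|nbhd_in H v A| + s * D #|nbhd_in H v (~: A)%SET| #|A|.-1.

Lemma nbhd_in_ub H v A : H \subset vpairs n -> v \in A ->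
  (#|nbhd_in H v A| <= #|A|.-1)%N.
Proof.
move=> /fintype.subsetP HE vA; rewrite (cardsD1 v A) vA /=.
apply/subset_leq_card/fintype.subsetP => u; rewrite !inE => /andP[-> /HE].
by rewrite andbT inE; case: (eqVneq u v) => [->|//]; rewrite cards2 eqxx.
Qed.

Lemma explored_le H A v : H \subset vpairs n -> v \in A ->
  explored H A v <= D 0 #|A|.
Proof.
move: p01 => /andP[p0 p1] HE vA; rewrite /explored.
have A1 : #|A| = #|A|.-1.+1 by rewrite prednK//; apply/card_gt0P; exists v.
have dn : (#|nbhd_in H v (~: A)%SET| <= n)%N.
  by rewrite -[X in (_ <= X)%N](card_ord n); exact: max_card.
rewrite [in leRHS]A1; apply: le_trans (D_vertex _ dn).
rewrite lerD2r lerD2l; rewrite -[leLHS]mulr_natr -[leRHS]mulr_natr.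
by apply: ler_wpM2l; [exact: mulr_ge0|rewrite ler_nat nbhd_in_ub].
Qed.

(** Reveal an undecided edge at v if there is one; otherwise v is finished, and
    the exploration goes on from any other vertex of A. *)
Lemma perc_le_explored H A v : H \subset vpairs n -> v \in A ->
  perc p H (F A) <= explored H A v.
Proof.
move: p01 => /andP[p0 p1].
(* Revealing an edge may enlarge A by one vertex, so edges count twice. *)
have [m] := ubnP (#|H|.*2 + #|A|); elim: m H A v => // m IHm H A v Hm HE vA.
have [u vuH|noedge] := pickP [pred u | [set v; u]%SET \in H].
  rewrite /= in vuH; set e := [set v; u]%SET in vuH *.
  have uv : u != v.
    move: (fintype.subsetP HE _ vuH); rewrite inE /e.
    by case: (eqVneq u v) => [->|//]; rewrite cards2 eqxx.
  set H' := (H :\ e)%SET.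
  have H'E : H' \subset vpairs n by apply: fintype.subset_trans HE; exact: subD1set.
  have cH : #|H| = #|H'|.+1 by rewrite (cardsD1 e) vuH.
  have IHA : perc p H' (F A) <= explored H' A v.
    by apply: IHm => //; move: Hm; rewrite cH; clear; lia.
  have IHu : perc p H' (F (u |: A)%SET) <= explored H' (u |: A)%SET v.
    apply: IHm => //; last by rewrite in_setU1 vA orbT.
    by move: Hm; rewrite cH cardsU1; case: (u \notin A); clear => /=; lia.
  have le1 : perc p H' (fun G => F A (e |: G)%SET)
      <= perc p H' (F (u |: A)%SET) + c *+ (u \in A).
    rewrite -[c *+ _](perc_cst p H') -percD; apply: le_perc => // G GH'.
    apply: F_edge => //; apply/negP => /(fintype.subsetP GH').
    by rewrite !inE eqxx.
  rewrite (perc_split _ _ vuH) -/H'.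
  have step : p * perc p H' (fun G => F A (e |: G)%SET) + (1 - p) * perc p H' (F A)
      <= p * (explored H' (u |: A)%SET v + c *+ (u \in A)) + (1 - p) * explored H' A v.
    apply: lerD; apply: ler_wpM2l => //; last by rewrite subr_ge0.
    by apply: (le_trans le1); rewrite lerD2r.
  apply: (le_trans step); rewrite {step le1 IHA IHu} /explored.
  rewrite !(nbhd_in_split _ uv vuH) -/H' !inE.
  have [uA|uA] /= := boolP (u \in A).
    have -> : (u |: A)%SET = A by apply/setUidPr; rewrite sub1set.
    by rewrite add0n add1n mulrS; rewrite le_eqVlt; apply/predU1P; left; ring.
  have -> : nbhd_in H' v (u |: A)%SET = nbhd_in H' v A.
    apply/setP => w; rewrite !inE; case: (eqVneq w u) => [->|//].
    by rewrite eqxx !andbF.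
  have -> : nbhd_in H' v (~: (u |: A))%SET = nbhd_in H' v (~: A)%SET.
    apply/setP => w; rewrite !inE; case: (eqVneq w u) => [->|//].
    by rewrite eqxx !andbF.
  rewrite cardsU1 uA /= add0n add1n.
  have A1 : #|A| = #|A|.-1.+1 by rewrite prednK//; apply/card_gt0P; exists v.
  have := D_edge #|nbhd_in H' v (~: A)%SET| #|A|.-1; rewrite -A1.
  move=> /(ler_wpM2l s0); rewrite -(lerD2l (b + p * c *+ #|nbhd_in H' v A|)).
  apply: le_trans; rewrite le_eqVlt mulr0n; apply/predU1P; left; ring.
have nbhd0 B : #|nbhd_in H v B| = 0%N.
  apply/eqP; rewrite cards_eq0; apply/eqP/setP => u.
  by rewrite !inE [_ \in H]noedge andbF.
have isol e : e \in H -> v \notin e.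
  move=> eH; apply/negP => /(vpairsP (fintype.subsetP HE _ eH))[u _ eE].
  by move: (noedge u); rewrite /= -eE eH.
have cA : #|(A :\ v)%SET| = #|A|.-1 by rewrite (cardsD1 v A) vA.
rewrite /explored !nbhd0 mulr0n addr0.
apply: (@le_trans _ _ (perc p H (fun G => b + s * F (A :\ v)%SET G))).
  apply: le_perc => // G GH; apply: F_vertex => // e /(fintype.subsetP GH).
  exact: isol.
rewrite percD perc_cst percZ lerD2l; apply: ler_wpM2l => //.
have [A0|[w wA]] := set_0Vmem (A :\ v)%SET.
  rewrite -cA A0 cards0 -[leRHS](perc_cst p H).
  by apply: le_perc => // G GH; apply: F_set0; exact: fintype.subset_trans HE.
rewrite -cA; apply: le_trans (explored_le HE wA); apply: IHm => //.
by move: Hm; rewrite (cardsD1 v A) vA add1n addnS ltnS.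
Qed.

Lemma perc_explore H A : H \subset vpairs n -> perc p H (F A) <= D 0 #|A|.
Proof.
move=> HE; have [->|[v vA]] := set_0Vmem A.
  rewrite cards0 -[leRHS](perc_cst p H); apply: le_perc => // G GH.
  by apply: F_set0; exact: fintype.subset_trans HE.
exact: le_trans (perc_le_explored HE vA) (explored_le HE vA).
Qed.

End Exploration.

(** * Subsolutions of the extinction equation *)

Section Extinction.
Variable R : realType.

Lemma expR_le_1B (y : R) : 0 <= y <= 2^-1 -> expR (- (y + 2 * y ^+ 2)) <= 1 - y.
Proof.
move=> /andP[y0 y2].
have y1 : 0 < 1 - y by lra.
rewrite expRN -[leRHS]invrK lef_pV2 ?posrE ?expR_gt0 ?invr_gt0//.
apply: le_trans (expR_ge1Dx _).
rewrite -[leLHS]mul1r ler_pdivrMr//.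
have := sqr_ge0 y.
have : 0 <= y ^+ 2 * (1 - 2 * y) by apply: mulr_ge0; [exact: sqr_ge0|lra].
by nra.
Qed.

Lemma le_1B_expR (m : R) : 0 <= m <= 1 -> 1 - m <= expR (- (m + m ^+ 2 / 4)).
Proof.
move=> /andP[m0 m1].
have h1 := expR_ge1Dx (- (m / 2)).
have h2 := expR_ge1Dx (- (m ^+ 2 / 4)).
have -> : - (m + m ^+ 2 / 4) = - (m / 2) + - (m / 2) + - (m ^+ 2 / 4) by field.
rewrite !expRD.
set a := expR (- (m / 2)) in h1 *; set b := expR _ in h2 *.
have a0 : 0 <= 1 - m / 2 by lra.
have b0 : 0 <= 1 - m ^+ 2 / 4 by nra.
apply: (@le_trans _ _ ((1 - m / 2) * (1 - m / 2) * (1 - m ^+ 2 / 4))).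
  have : 0 <= m ^+ 3 * (1 - m / 4) by apply: mulr_ge0; [exact: exprn_ge0|lra].
  by nra.
by apply: ler_pM => //; [exact: mulr_ge0|apply: ler_pM].
Qed.

(** Take phi = 1 - m with m = 16 L theta, or phi = 0 if m >= 1.  Taking
    logarithms, -ln(1 - m) >= m + m^2/4 has to dominate
    theta^2 + n (-ln(1 - pm)), which is at most theta^2 + m + L theta m up to
    terms of order n (pm)^2.  The linear terms cancel, and the quadratic term
    m^2/4 = 64 (L theta)^2 exceeds the remaining ones because 16 is large
    enough.  The lower bound on n makes n (pm)^2 negligible. *)
Lemma extinction_bound (n : nat) (p th L : R) :
  0 <= p <= 1 -> 1 <= L -> 0 < th ->
  p * n%:R <= 1 + L * th -> 1 <= n%:R * (L * th) ^+ 3 ->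
  exists2 phi : R, 0 <= phi <= 1 /\ 1 - phi <= 16 * L * th &
    phi <= (1 + th ^+ 2)^-1 * (1 - p + p * phi) ^+ n.
Proof.
move=> /andP[p0 p1] L1 th0 pn nl.
set l := L * th in pn nl.
have l0 : 0 < l by apply: mulr_gt0 => //; lra.
have thl : th ^+ 2 <= l ^+ 2.
  apply: lerXn2r; rewrite ?nnegrE ?(ltW th0) ?(ltW l0)//.
  by rewrite /l ler_peMl// ltW.
have th1 : 0 < 1 + th ^+ 2 by rewrite ltr_pwDl// sqr_ge0.
have [m1|m1] := leP 1 (16 * l).
  exists 0; first by split; [rewrite lexx ler01|rewrite subr0 -mulrA].
  by rewrite mulr0 addr0 mulr_ge0 ?exprn_ge0 ?subr_ge0// invr_ge0 ltW.
exists (1 - 16 * l); first by split; [lra|rewrite -mulrA -/l; lra].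
rewrite [leRHS]mulrC ler_pdivlMr//; set m := 16 * l in m1 *.
set y := p * m.
have pl : p <= 2 * l ^+ 3.
  have l3 : 0 <= l ^+ 3 by apply: exprn_ge0; lra.
  have h1 := ler_wpM2l p0 nl.
  have h2 := ler_wpM2r l3 pn.
  have h3 : (1 + l) * l ^+ 3 <= 2 * l ^+ 3 by apply: ler_wpM2r => //; rewrite /m in m1; lra.
  by rewrite mulr1 mulrA in h1; lra.
have y0 : 0 <= y by rewrite /y mulr_ge0// /m; lra.
have l3b : l ^+ 3 <= l / 256.
  have -> : l ^+ 3 = l ^+ 2 * l by ring.
  rewrite mulrC; apply: ler_wpM2l; first lra.
  by rewrite /m in m1; nra.
have y2 : y <= 2^-1.
  rewrite /y; apply: (@le_trans _ _ (p * 1)); first by apply: ler_wpM2l => //; lra.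
  by rewrite /m in m1; lra.
have e1 : expR (- (n%:R * (y + 2 * y ^+ 2))) <= (1 - p + p * (1 - m)) ^+ n.
  have -> : 1 - p + p * (1 - m) = 1 - y by rewrite /y; ring.
  rewrite -mulrN mulrC expRM_natr.
  apply: lerXn2r; rewrite ?nnegrE ?expR_ge0//; first lra.
  by apply: expR_le_1B; rewrite y0.
apply: le_trans e1.
apply: (@le_trans _ _ (expR (- (m + m ^+ 2 / 4)) * expR (th ^+ 2))).
  apply: ler_pM.
  - lra.
  - by rewrite addr_ge0// sqr_ge0.
  - by apply: le_1B_expR; rewrite /m in m1 *; lra.
  - exact: expR_ge1Dx.
rewrite -expRD ler_expR.
have ny : n%:R * y <= (1 + l) * m.
  rewrite /y mulrA [n%:R * p]mulrC; apply: ler_wpM2r => //; rewrite /m; lra.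
have ny2 : n%:R * y ^+ 2 <= 4 * l ^+ 2 * l.
  have -> : n%:R * y ^+ 2 = (n%:R * y) * (p * m) by rewrite /y; ring.
  apply: (@le_trans _ _ ((2 * m) * ((2 * (l / 256)) * m))); last by rewrite /m; nra.
  have m0 : 0 <= m by rewrite /m; lra.
  apply: ler_pM.
  - by rewrite mulr_ge0.
  - by rewrite mulr_ge0.
  - by apply: (le_trans ny); apply: ler_wpM2r => //; rewrite /m in m1; lra.
  - by apply: ler_wpM2r => //; lra.
by rewrite /m in ny *; nra.
Qed.
End Extinction.

(** * Size and surplus of the component of a vertex *)

Section Bounds.
Variables (R : realFieldType) (n : nat) (p s phi : R).
Hypothesis p01 : 0 <= p <= 1.
Hypothesis s01 : 0 <= s <= 1.
Hypothesis phi01 : 0 <= phi <= 1.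
Hypothesis phi_sub : phi <= s * (1 - p + p * phi) ^+ n.

(* The generating function, at phi, of a single potential edge. *)
Let q := 1 - p + p * phi.

Lemma q01 : 0 <= q <= 1.
Proof.
move: p01 phi01 => /andP[p0 p1] /andP[f0 f1].
have : 0 <= p * phi by exact: mulr_ge0.
have : 0 <= p * (1 - phi) by apply: mulr_ge0 => //; lra.
rewrite /q; lra.
Qed.

Lemma phi_step d j : (d <= n)%N -> phi ^+ j.+1 <= s * (phi ^+ j * q ^+ d).
Proof.
move=> dn; move: s01 phi01 q01 => /andP[s0 _] /andP[f0 _] /andP[q0 q1].
rewrite exprSr mulrCA; apply: ler_wpM2l; first exact: exprn_ge0.
by apply: (le_trans phi_sub); apply: ler_wpM2l => //; apply: ler_wiXn2l.
Qed.

(** Think of phi as the probability that no vertex of a lineage is killed.  Then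
    D d j = 1 - phi^j q^d is the probability of a killing in j independent
    lineages and those born through d further potential edges. *)
Lemma perc_size_le (v : 'I_n) :
  perc p (vpairs n) (fun G => 1 - s ^+ #|reach G [set v]%SET|) <= 1 - phi.
Proof.
have -> : 1 - phi = 1 - phi ^+ #|[set v]%SET| * q ^+ 0.
  by rewrite cards1 expr0 expr1 mulr1.
apply: (@perc_explore _ _ _ p01 (fun A G => 1 - s ^+ #|reach G A|)
   (fun d j => 1 - phi ^+ j * q ^+ d) s (1 - s) 0) => //.
- by case/andP: s01.
- by move=> G _; rewrite reach0 cards0 !expr0 mulr1.
- by move=> G A u w Aw _; rewrite reach_add_edge// mul0rn addr0.
- move=> G A w Aw Gw; have [-> wr] := reach_isolated Aw Gw.
  rewrite cardsU1 wr /= add1n exprS; move: (s ^+ _) => x; lra.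
- move=> d j; rewrite /= (exprS phi j) (exprS q d) le_eqVlt; apply/predU1P; left.
  move: (phi ^+ j) (q ^+ d) => x y.
  by rewrite /q; ring.
- move=> d j /phi_step => /(_ j); rewrite mulr0 mul0rn addr0.
  move: (phi ^+ j.+1) (phi ^+ j * q ^+ d) => x y; lra.
Qed.

(** Write al = 1 / (1 - s).  The linear function al j pays for the cycles closed
    at the current vertex, since it loses (1 - s) al j = j in each step.  The
    drift delta adds s al delta to it; this is compensated by be (1 - phi^j),
    whose discounted expectation decreases by at least be (1 - s) in each
    step. *)
Lemma perc_excess_le (delta : R) (v : 'I_n) : s < 1 -> 0 <= delta ->
  p * n%:R <= 1 + delta ->
  perc p (vpairs n) (fun G =>
      s ^+ #|reach G [set v]%SET| * (excess G [set v]%SET)%:R)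
  <= p * ((1 - s)^-1 + s * delta * (1 - s) ^- 2 * (1 - phi)).
Proof.
move=> s1 d0 pn; move: p01 s01 => /andP[p0 p1] /andP[s0 _].
set al := (1 - s)^-1; set be := s * delta * (1 - s) ^- 2.
have s1' : 1 - s != 0 by lra.
have al0 : 0 <= al by rewrite invr_ge0; lra.
have be0 : 0 <= be by rewrite mulr_ge0 ?mulr_ge0// invr_ge0 exprn_ge0//; lra.
have alE : s * al = al - 1 by rewrite /al; field.
have beE : be = s * be + s * al * delta by rewrite /al /be; field.
pose D d j : R := p * (al * (j%:R + d%:R * p) + be * (1 - phi ^+ j * q ^+ d)).
have -> : p * (al + be * (1 - phi)) = D 0 #|[set v]%SET|.
  by rewrite /D cards1 expr0 expr1 mulr1 mul0r addr0 mulr1.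
apply: (@perc_explore _ _ _ p01 (fun A G => s ^+ #|reach G A| * (excess G A)%:R)
   D s 0 1) => //.
- move=> G GE; rewrite excess0// mulr0 /D !expr0 mulr1 subrr !mulr0.
  by rewrite addr0 mul0r addr0 mulr0 mulr0.
- move=> G A u w Aw wuG; rewrite reach_add_edge//.
  have sC0 : 0 <= s ^+ #|reach G (u |: A)%SET| by exact: exprn_ge0.
  have sC1 : s ^+ #|reach G (u |: A)%SET| <= 1 by apply: exprn_ile1 => //; exact: ltW.
  have := excess_add_edge Aw wuG; rewrite -(ler_nat R) natrD.
  move=> /(ler_wpM2l sC0) /le_trans; apply; rewrite mulrDr lerD2l.
  by case: (u \in A); rewrite ?mulr1 ?mulr0.
- move=> G A w Aw Gw; rewrite (excess_isolated Aw Gw).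
  have [-> wr] := reach_isolated Aw Gw.
  by rewrite cardsU1 wr /= add1n exprS add0r mulrA.
- move=> d j; rewrite /D (exprS phi j) (exprS q d) le_eqVlt; apply/predU1P; left.
  by rewrite -!natr1; move: (phi ^+ j) (q ^+ d) => x y; rewrite /q; ring.
- move=> d j dn; have := phi_step j dn => hphi.
  rewrite /D add0r mulr1 expr0 mulr1 mul0r addr0 -natr1 -[p *+ j]mulr_natr.
  rewrite mulrCA -mulrDr; apply: ler_wpM2l => //.
  have dp : d%:R * p <= 1 + delta.
    by apply: le_trans pn; rewrite mulrC; apply: ler_wpM2l => //; rewrite ler_nat.
  have sal0 : 0 <= s * al by exact: mulr_ge0.
  have h1 := ler_wpM2l sal0 dp.
  have h2 := ler_wpM2l be0 hphi.
  have -> : j%:R + s * (al * (j%:R + d%:R * p) + be * (1 - phi ^+ j * q ^+ d))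
     = j%:R + s * al * j%:R + s * al * (d%:R * p) + s * be
        - be * (s * (phi ^+ j * q ^+ d)) by ring.
  have -> : al * (j%:R + 1) + be * (1 - phi ^+ j.+1)
     = al * j%:R + al + be - be * phi ^+ j.+1 by ring.
  have e3 : j%:R + s * al * j%:R = al * j%:R by rewrite alE; ring.
  have e4 : s * al * (1 + delta) = al - 1 + s * al * delta.
    by rewrite mulrDr mulr1 {1}alE.
  move: h1 h2 e3 e4 beE; clear; lra.
Qed.

End Bounds.

(** * From vertices to components *)

Section Components.
Import boot.fintype boot.finset.
Variables (R : realDomainType) (n : nat).
Implicit Types (G : {set {set 'I_n}}) (C : {set 'I_n}).

Lemma sum_components G (f : {set 'I_n} -> R) :
  \sum_(C in components G) #|C|%:R * f C = \sum_v f (reach G [set v]%SET).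
Proof.
have -> : \sum_v f (reach G [set v]%SET)
    = \sum_(v in [set: 'I_n]%SET) f (reach G [set v]%SET).
  by apply: eq_bigl => v; rewrite inE.
rewrite (set_partition_big _ (components_partition G)) /=.
apply: eq_bigr => C CG; rewrite mulr_natl -sumr_const.
by apply: eq_bigr => v vC; rewrite -(component_reach CG vC).
Qed.

(** Ranks beyond the number of components contribute g set0 = 0. *)
Lemma sum_ranked_le G (g : {set 'I_n} -> R) N : (forall C, 0 <= g C) -> g set0 = 0 ->
  \sum_(1 <= i < N) g (ranked_component G i) <= \sum_(C in components G) g C.
Proof.
move=> g0 gset0; rewrite /ranked_component.
rewrite big_add1 /=; set r := ranked_components G.
have -> : \sum_(C in components G) g C = \sum_(0 <= i < size r) g (nth set0 r i).
  rewrite -(big_nth set0 xpredT g) -big_enum /=; apply: perm_big.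
  by rewrite perm_sym perm_sort.
have : \sum_(0 <= i < N.-1) g (nth set0 r i)
    <= \sum_(0 <= i < N.-1 + size r) g (nth set0 r i).
  rewrite (@big_cat_nat _ _ _ N.-1 0 (N.-1 + size r))//= ?leq_addr//.
  by rewrite lerDl sumr_ge0.
move=> /le_trans; apply.
rewrite (@big_cat_nat _ _ _ (size r) 0 (N.-1 + size r))//= ?leq_addl//.
rewrite -[leRHS]addr0 lerD2l big_nat_cond big1// => i /andP[/andP[ri _] _].
by rewrite nth_default.
Qed.

End Components.

(** * Killing at a given size *)

Section Killing.
Variable R : realType.
Implicit Types (g : R) (k : nat).

Lemma bernoulli_le g k : 0 <= g -> 1 + k%:R * g <= (1 + g) ^+ k.
Proof.
move=> g0; elim: k => [|k IHk]; first by rewrite mul0r addr0 expr0.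
have g1 : 0 <= 1 + g by rewrite addr_ge0.
rewrite exprS; apply: le_trans (ler_wpM2l g1 IHk).
have : 0 <= k%:R * g * g by rewrite !mulr_ge0.
rewrite -natr1; move: k%:R => z; nra.
Qed.

(** Among k vertices, each killed with probability g / (1 + g), one is killed
    with probability comparable to k g as long as k g <= 1; this turns a
    truncated size into a killing probability. *)
Lemma size_le_killed g k : 0 <= g -> k%:R * g <= 1 ->
  k%:R * g <= 2 * (1 - (1 + g)^-1 ^+ k).
Proof.
move=> g0 kg1; have kg0 : 0 <= k%:R * g by rewrite mulr_ge0.
have := bernoulli_le k g0; rewrite exprVn.
set y := (1 + g) ^+ k; move: kg0 kg1; move: (k%:R * g) => z z0 z1 zy.
have y0 : 0 < y by apply: lt_le_trans zy; lra.
have -> : 2 * (1 - y^-1) = (2 * (y - 1)) / y by field; rewrite gt_eqF.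
rewrite ler_pdivlMr//.
have : 0 <= (2 - z) * (y - 1 - z) by apply: mulr_ge0; lra.
nra.
Qed.

(** Components with k g <= 1 survive the killing with probability at least 1/e,
    so the weight s^k can replace the restriction on the size. *)
Lemma killed_ge g k : 0 <= g -> k%:R * g <= 1 ->
  1 <= expR 1 * (1 + g)^-1 ^+ k.
Proof.
move=> g0 kg1; rewrite exprVn ler_pdivlMr ?mul1r; last first.
  by rewrite exprn_gt0// ltr_pwDl.
apply: (@le_trans _ _ (expR g ^+ k)).
  apply: lerXn2r; rewrite ?nnegrE ?expR_ge0 ?addr_ge0//.
  exact: expR_ge1Dx.
by rewrite -expRM_natl ler_expR.
Qed.

End Killing.

(** * The critical window *)

Section Critical.
Variable R : realType.
Implicit Types (lam L th : R) (n : nat).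

(** The width n^(-1/3) of the critical window: np = 1 + lam (window n), and
    rescaled sizes are measured in units of (window n)^(-2). *)
Definition window n : R := n%:R `^ (- (1 / 3)).

Lemma window_gt0 n : (0 < n)%N -> 0 < window n.
Proof. by move=> n0; rewrite powR_gt0// ltr0n. Qed.

Lemma powR_window n k : n%:R `^ (- (k%:R / 3)) = window n ^+ k.
Proof.
rewrite /window -powR_mulrn ?powR_ge0// -powRrM.
by congr (_ `^ _); field.
Qed.

Lemma window3 n : (0 < n)%N -> n%:R * window n ^+ 3 = 1.
Proof.
move=> n0; rewrite -powR_window divff ?pnatr_eq0// powR_inv1 ?ler0n//.
by rewrite mulfV// pnatr_eq0 -lt0n.
Qed.

Lemma window_le1 n : (0 < n)%N -> window n <= 1.
Proof.
move=> n0; rewrite leNgt; apply/negP => x1.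
have := window3 n0; apply/eqP; rewrite gt_eqF//.
have n1 : (1 : R) <= n%:R by rewrite ler1n.
have x3 : 1 < window n ^+ 3 by rewrite exprn_egt1.
by apply: (lt_le_trans x3); rewrite ler_peMl// (le_trans _ (ltW x3)).
Qed.

Lemma critical_p_window lam n : (0 < n)%N ->
  critical_p lam n * n%:R = 1 + lam * window n.
Proof.
move=> n0; have nn0 : (n%:R : R) != 0 by rewrite pnatr_eq0 -lt0n.
rewrite /critical_p powR_window mulrDl mulVf//.
have -> : lam * window n ^+ 4 * n%:R = lam * window n * (n%:R * window n ^+ 3) by ring.
by rewrite window3// mulr1.
Qed.

Lemma rescaled_size_window n (C : {set 'I_n}) :
  rescaled_size R C = window n ^+ 2 * #|C|%:R.
Proof. by rewrite /rescaled_size powR_window. Qed.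

(** Up to the factor L, theta is not below the width of the critical window;
    this bounds the drift of the walk by L theta and makes n large enough. *)
Lemma critical_extinction lam n L th : (0 < n)%N ->
  0 <= critical_p lam n <= 1 -> 1 <= L -> 0 < th ->
  (1 + `|lam|) * window n <= L * th ->
  exists2 phi : R, 0 <= phi <= 1 /\ 1 - phi <= 16 * L * th &
    phi <= (1 + th ^+ 2)^-1 * (1 - critical_p lam n + critical_p lam n * phi) ^+ n.
Proof.
move=> n0 p01 L1 th0 xL; have x0 := window_gt0 n0.
have lx : lam * window n <= `|lam| * window n.
  by apply: ler_wpM2r; [exact: ltW|exact: ler_norm].
have lx0 : 0 <= `|lam| * window n by rewrite mulr_ge0// ltW.
apply: extinction_bound => //.
  by rewrite critical_p_window//; lra.
rewrite -[X in X <= _](window3 n0); apply: ler_wpM2l => //.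
by apply: lerXn2r; rewrite ?nnegrE; lra.
Qed.

Lemma ER_expectation_le n (p : R) (f : {set {set 'I_n}} -> \bar R) g :
  0 <= p <= 1 -> (forall G, (f G <= (g G)%:E)%E) ->
  (ER_expectation p f <= (perc p (vpairs n) g)%:E)%E.
Proof.
move=> /andP[p0 p1] fg; rewrite /ER_expectation /perc -sumEFin.
apply: lee_sum => G _; rewrite EFinM lee_wpmul2l// lee_fin.
by apply: prodr_ge0 => e _; case: ifP => // _; rewrite subr_ge0.
Qed.

(** One factor of X^2 is proportional to the size, hence becomes a sum over
    vertices; the other is at most eps times a killing probability. *)
Lemma small_components_le n (G : {set {set 'I_n}}) (eps : R) :
  (0 < n)%N -> 0 < eps ->
  (\sum_(1 <= i <oo | (Xn R G i <= eps)%R) ((Xn R G i) ^+ 2)%:E <=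
   (2 * eps * window n ^+ 2 * \sum_v
      (1 - (1 + window n ^+ 2 / eps)^-1 ^+ #|reach G [set v]%SET|))%:E)%E.
Proof.
move=> n0 eps0; have x0 := window_gt0 n0; set x := window n in x0 *.
pose s : R := (1 + x ^+ 2 / eps)^-1; rewrite -/s.
have g0 : 0 <= x ^+ 2 / eps by rewrite divr_ge0 ?sqr_ge0// ltW.
pose f (C : {set 'I_n}) : R :=
  if rescaled_size R C <= eps then rescaled_size R C ^+ 2 else 0.
have f0 C : 0 <= f C by rewrite /f; case: ifP => // _; exact: sqr_ge0.
apply: lime_le.
  by apply: is_cvg_nneseries_cond => i _ _; rewrite lee_fin sqr_ge0.
apply: nearW => N; rewrite sumEFin lee_fin.
have -> : \sum_(1 <= i < N | Xn R G i <= eps) Xn R G i ^+ 2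
    = \sum_(1 <= i < N) f (ranked_component G i) by rewrite big_mkcond.
apply: (le_trans (sum_ranked_le _ _ f0 _)).
  by rewrite /f rescaled_size_window cards0 mulr0 expr0n; case: ifP.
rewrite -(sum_components G (fun C => 1 - s ^+ #|C|)) mulr_sumr.
apply: ler_sum => C _; rewrite /f rescaled_size_window -/x.
have s01 : 0 <= s <= 1.
  by rewrite invr_ge0 invf_le1 ?lerDl ?g0 ?addr_ge0// ltr_pwDl.
have sC : 0 <= 1 - s ^+ #|C|.
  by case/andP: s01 => ? ?; rewrite subr_ge0 exprn_ile1.
case: ifP => [Xeps|_]; last first.
  by rewrite !mulr_ge0// ?sqr_ge0// ltW.
have Xg : x ^+ 2 * #|C|%:R = eps * (#|C|%:R * (x ^+ 2 / eps)).
  by field; rewrite gt_eqF.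
have : #|C|%:R * (x ^+ 2 / eps) <= 1.
  by rewrite mulrA ler_pdivrMr// mul1r mulrC.
move=> /(size_le_killed g0)/(ler_wpM2l (ltW eps0)); rewrite -Xg -/s => h.
rewrite expr2; have X0 : 0 <= x ^+ 2 * #|C|%:R by rewrite mulr_ge0// sqr_ge0.
apply: le_trans (ler_wpM2l X0 h) _.
move: (1 - _) (#|C|%:R) => y k; rewrite le_eqVlt; apply/predU1P; left; ring.
Qed.

Lemma expected_small_components lam n (eps : R) : (0 < n)%N ->
  0 <= critical_p lam n <= 1 -> 0 < eps <= 1 ->
  (ER_expectation (critical_p lam n) (fun G : {set {set 'I_n}} =>
     \sum_(1 <= i <oo | (Xn R G i <= eps)%R) ((Xn R G i) ^+ 2)%:E)
   <= (32 * (1 + `|lam|) * Num.sqrt eps)%:E)%E.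
Proof.
move=> n0 p01 /andP[eps0 eps1]; have x0 := window_gt0 n0.
apply: (le_trans (ER_expectation_le p01 (fun G => small_components_le G n0 eps0))).
rewrite lee_fin percZ perc_sum.
set x := window n in x0 *; set r := Num.sqrt eps.
(* Killing at size eps n^(2/3) corresponds to theta = n^(-1/3) / sqrt eps. *)
have r0 : 0 < r by rewrite sqrtr_gt0.
have r2 : r ^+ 2 = eps by rewrite sqr_sqrtr// ltW.
have r1 : r <= 1 by rewrite -sqrtr1 ler_wsqrtr.
have L1 : 1 <= 1 + `|lam| by rewrite lerDl.
have th0 : 0 < x / r by exact: divr_gt0.
have xth : (1 + `|lam|) * x <= (1 + `|lam|) * (x / r).
  apply: ler_wpM2l; first lra.
  by rewrite ler_pdivlMr// ler_piMr// ltW.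
have [phi [phi01 phi1]] := critical_extinction n0 p01 L1 th0 xth.
rewrite exprMn exprVn r2 => phis.
have g0 : 0 <= x ^+ 2 / eps by rewrite divr_ge0 ?sqr_ge0// ltW.
have s01 : 0 <= (1 + x ^+ 2 / eps)^-1 <= 1.
  by rewrite invr_ge0 invf_le1 ?lerDl ?g0 ?addr_ge0// ltr_pwDl.
have hsum : \sum_(i < n) perc (critical_p lam n) (vpairs n)
   (fun G => 1 - (1 + x ^+ 2 / eps)^-1 ^+ #|reach G [set i]%SET|)
   <= n%:R * (16 * (1 + `|lam|) * (x / r)).
  rewrite mulr_natl -[X in _ *+ X]card_ord -sumr_const; apply: ler_sum => i _.
  by apply: le_trans phi1; exact: (perc_size_le p01 s01 phi01 phis).
have c0 : 0 <= 2 * eps * x ^+ 2.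
  by rewrite !mulr_ge0 ?sqr_ge0// ltW.
apply: le_trans (ler_wpM2l c0 hsum) _.
have -> : 2 * eps * x ^+ 2 * (n%:R * (16 * (1 + `|lam|) * (x / r)))
   = 32 * (1 + `|lam|) * r * (n%:R * x ^+ 3).
  by rewrite -r2; field; rewrite gt_eqF.
by rewrite window3// mulr1.
Qed.

(** The indicator of a component with a <= X <= b and surplus at least r + 1 is
    at most the product of X / a, of its surplus over r + 1, and of e s^|C|. *)
Lemma Xi_le n (G : {set {set 'I_n}}) (a b : R) r : (0 < n)%N -> 0 < a -> 0 < b ->
  (Xi G ([set` `[a, b]] `*` [set k : nat | (r.+1 <= k)%N]) <=
   (window n ^+ 2 * expR 1 / a * harmonic r * \sum_v
      ((1 + (window n / (1 + b)) ^+ 2)^-1 ^+ #|reach G [set v]%SET| *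
       (excess G [set v]%SET)%:R))%:E)%E.
Proof.
move=> n0 a0 b0; have x0 := window_gt0 n0; set x := window n in x0 *.
set A : set (R * nat) := _ `*` _.
set s : R := (1 + (x / (1 + b)) ^+ 2)^-1.
have s0 : 0 <= s by rewrite invr_ge0 addr_ge0// sqr_ge0.
have x20 : 0 <= x ^+ 2 by rewrite sqr_ge0.
under eq_bigr do rewrite -surplus_excess.
rewrite -(sum_components G (fun C => s ^+ #|C| * (surplus G C)%:R)) mulr_sumr -sumEFin.
apply: lee_sum => C _; rewrite diracE lee_fin.
set X := rescaled_size R C.
have rhs0 : 0 <= x ^+ 2 * expR 1 / a * harmonic r *
    (#|C|%:R * (s ^+ #|C| * (surplus G C)%:R)).
  by rewrite !mulr_ge0 ?expR_ge0 ?invr_ge0 ?exprn_ge0 ?ler0n// ltW.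
have [|_] := boolP ((X, surplus G C) \in A); last exact: rhs0.
rewrite inE => -[/=]; rewrite in_itv /= => /andP[aX Xb] rk.
have XE : X = x ^+ 2 * #|C|%:R by rewrite /X rescaled_size_window.
have k0 : 0 <= (#|C|%:R : R) by exact: ler0n.
have h1 : 1 <= X / a by rewrite ler_pdivlMr// mul1r.
have h2 : 1 <= harmonic r * (surplus G C)%:R :> R.
  by rewrite /= mulrC ler_pdivlMr ?ltr0n// mul1r ler_nat.
have h3 : 1 <= expR 1 * s ^+ #|C|.
  apply: killed_ge; first exact: sqr_ge0.
  have -> : #|C|%:R * (x / (1 + b)) ^+ 2 = X / (1 + b) ^+ 2.
    by rewrite XE exprMn exprVn mulrA [_ * x ^+ 2]mulrC.
  rewrite ler_pdivrMr ?exprn_gt0 ?addr_gt0// mul1r; apply: (le_trans Xb).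
  by nra.
have -> : x ^+ 2 * expR 1 / a * harmonic r *
    (#|C|%:R * (s ^+ #|C| * (surplus G C)%:R))
  = (X / a) * ((harmonic r * (surplus G C)%:R) * (expR 1 * s ^+ #|C|)).
  rewrite XE; move: (harmonic r) (s ^+ _) (expR 1) => u v w; ring.
by rewrite mulr_ege1// mulr_ege1.
Qed.

Lemma expected_Xi lam n (a b : R) r : (0 < n)%N ->
  0 <= critical_p lam n <= 1 -> 0 < a -> 0 < b ->
  (ER_expectation (critical_p lam n) (fun G : {set {set 'I_n}} =>
     Xi G ([set` `[a, b]] `*` [set k : nat | (r.+1 <= k)%N]))
   <= (2 * expR 1 / a * (1 + `|lam|) * (1 + b) ^+ 2 *
       (1 + 16 * ((1 + `|lam|) * (1 + b)) ^+ 2) * harmonic r)%:E)%E.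
Proof.
move=> n0 p01 a0 b0; have x0 := window_gt0 n0; have x1 := window_le1 n0.
apply: (le_trans (ER_expectation_le p01 (fun G => Xi_le G r n0 a0 b0))).
have pn := critical_p_window lam n0; have n3 := window3 n0.
rewrite lee_fin percZ perc_sum.
set p := critical_p lam n in p01 pn *.
set x := window n in x0 x1 pn n3 *; set t := 1 + b; set l := 1 + `|lam|.
(* With theta = n^(-1/3) / (1 + b), every component with X <= b satisfies
   |C| theta^2 <= b / (1 + b)^2 <= 1. *)
set th := x / t; set L := l * t.
have t1 : 1 <= t by rewrite /t; lra.
have t0 : 0 < t by lra.
have l1 : 1 <= l by rewrite /l lerDl.
have L1 : 1 <= L by rewrite /L mulr_ege1.
have th0 : 0 < th by exact: divr_gt0.
have xth : l * x <= L * th.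
  by rewrite /L /th le_eqVlt; apply/predU1P; left; field; rewrite gt_eqF.
have th1 : th ^+ 2 <= 1.
  rewrite expr_le1// ?(ltW th0)// /th ler_pdivrMr// mul1r; lra.
have [phi [phi01 phi1] phis] := critical_extinction n0 p01 L1 th0 xth.
rewrite -/p in phis.
have th20 : 0 < th ^+ 2 by rewrite exprn_gt0.
set s := (1 + th ^+ 2)^-1 in phis *.
have s01 : 0 <= s <= 1.
  by rewrite invr_ge0 invf_le1 ?lerDl ?addr_ge0 ?ltW// ltr_pwDl// ltW.
have s1 : s < 1 by rewrite invf_lt1 ?ltrDl// ltr_pwDl// ltW.
have pnL : p * n%:R <= 1 + L * th.
  rewrite pn lerD2l; apply: le_trans xth.
  by apply: ler_wpM2r; [exact: ltW|rewrite /l; have := ler_norm lam; lra].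
have pnl : p * n%:R <= l.
  rewrite pn /l lerD2l; apply: (@le_trans _ _ (`|lam| * x)).
    by apply: ler_wpM2r; [exact: ltW|exact: ler_norm].
  by rewrite ler_piMr.
have L0 : 0 <= L by exact: le_trans ler01 L1.
have Lth0 : 0 <= L * th by rewrite mulr_ge0// ltW.
pose W := p * ((1 - s)^-1 + s * (L * th) * (1 - s) ^- 2 * (1 - phi)).
have p0 : 0 <= p by case/andP: p01.
have hsum : \sum_(i < n) perc p (vpairs n)
   (fun G => s ^+ #|reach G [set i]%SET| * (excess G [set i]%SET)%:R) <= n%:R * W.
  rewrite mulr_natl -[X in _ *+ X]card_ord -sumr_const; apply: ler_sum => i _.
  exact: (perc_excess_le p01 s01 phi01 phis i s1 Lth0 pnL).
have c0 : 0 <= x ^+ 2 * expR 1 / a * harmonic r.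
  by rewrite !mulr_ge0// ?sqr_ge0 ?expR_ge0 ?invr_ge0 ?ltW.
apply: le_trans (ler_wpM2l c0 hsum) _.
have WE : W = p * ((1 + th ^+ 2) / th ^+ 2 * (1 + L / th * (1 - phi))).
  have th1n0 : 1 + th ^+ 2 != 0 by rewrite gt_eqF// addr_gt0.
  have sE : 1 - s = th ^+ 2 / (1 + th ^+ 2) by rewrite /s; field.
  by rewrite /W sE /s; field; rewrite th1n0 gt_eqF.
have Wle : x ^+ 2 * (n%:R * W) <= l * (2 * t ^+ 2 * (1 + 16 * L ^+ 2)).
  have -> : x ^+ 2 * (n%:R * W) = p * n%:R *
      ((1 + th ^+ 2) * t ^+ 2 * (1 + L / th * (1 - phi))).
    by rewrite WE /th; field; rewrite !gt_eqF.
  have phi0 : 0 <= 1 - phi by rewrite subr_ge0; case/andP: phi01.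
  have h : L / th * (1 - phi) <= 16 * L ^+ 2.
    have Lt0 : 0 <= L / th by rewrite divr_ge0// ltW.
    apply: le_trans (ler_wpM2l Lt0 phi1) _; rewrite le_eqVlt; apply/predU1P.
    by left; field; rewrite gt_eqF.
  have h0 : 0 <= L / th * (1 - phi) by rewrite mulr_ge0 ?divr_ge0// ltW.
  apply: ler_pM => //.
  - by rewrite mulr_ge0.
  - by rewrite !mulr_ge0 ?sqr_ge0 ?addr_ge0// ltW.
  - apply: ler_pM.
    + by rewrite mulr_ge0 ?sqr_ge0 ?addr_ge0// ltW.
    + by rewrite addr_ge0.
    + by apply: ler_wpM2r; [exact: sqr_ge0|lra].
    + by rewrite lerD2l.
have c1 : 0 <= expR 1 / a * harmonic r.
  by rewrite !mulr_ge0// ?expR_ge0 ?invr_ge0 ?ltW.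
have := ler_wpM2l c1 Wle; set h := harmonic r; set e := expR 1.
move: (n%:R * W) => z hz.
have -> : x ^+ 2 * e / a * h * z = e / a * h * (x ^+ 2 * z) by ring.
apply: le_trans hz _; rewrite le_eqVlt; apply/predU1P; left.
by ring.
Qed.

End Critical.

Theorem proposition4p3 (R : realType) (lam : R) (nlam : nat)
  (hnlam : forall n : nat, (nlam <= n)%N -> 0 < critical_p lam n < 1) :
  (exists C : R, forall eps : R, 0 < eps <= 1 ->
    (ereal_sup
       [set ER_expectation (critical_p lam n) (fun G : {set {set 'I_n}} =>
              \sum_(1 <= i <oo | (Xn R G i <= eps)%R) ((Xn R G i) ^+ 2)%:E)
       | n in [set n : nat | (nlam <= n)%N]]
     <= (C * Num.sqrt eps)%:E)%E) /\
  (forall a b : R, 0 < a -> a < b ->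
    (fun r : nat =>
       ereal_sup
         [set ER_expectation (critical_p lam n) (fun G : {set {set 'I_n}} =>
                Xi G ([set` `[a, b]] `*` [set k : nat | (r.+1 <= k)%N]))
         | n in [set n : nat | (nlam <= n)%N]]) @ \oo --> 0%E).
Proof.
(* The hypothesis on nlam excludes n = 0, where the edge probability is 0. *)
have n_gt0 n : (nlam <= n)%N -> (0 < n)%N.
  case: n => // /hnlam; rewrite /critical_p powR0; last first.
    by rewrite oppr_eq0 gt_eqF// divr_gt0.
  by rewrite mulr0 addr0 invr0 ltxx.
have p01 n : (nlam <= n)%N -> 0 <= critical_p lam n <= 1.
  by move=> /hnlam /andP[p0 p1]; rewrite !ltW.
split.
  exists (32 * (1 + `|lam|)) => eps eps01; apply: ge_ereal_sup => _ [n /= nn <-].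
  by apply: expected_small_components => //; [exact: n_gt0|exact: p01].
move=> a b a0 ab; have b0 : 0 < b by exact: lt_trans ab.
set K : R := 2 * expR 1 / a * (1 + `|lam|) * (1 + b) ^+ 2 *
       (1 + 16 * ((1 + `|lam|) * (1 + b)) ^+ 2).
apply: (@squeeze_cvge _ _ _ _ (fun=> 0%E) _ (fun r => (K * harmonic r)%:E)).
- apply: nearW => r; apply/andP; split; last first.
    apply: ge_ereal_sup => _ [n /= nn <-].
    by apply: expected_Xi => //; [exact: n_gt0|exact: p01].
  apply: le_ereal_sup_tmp; eexists; first by exists nlam; [exact: leqnn|reflexivity].
  apply: sume_ge0 => G _; apply: mule_ge0.
    have /andP[p0 p1] := p01 _ (leqnn nlam).
    by rewrite lee_fin; apply: prodr_ge0 => e _; case: ifP => // _; rewrite subr_ge0.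
  by apply: sume_ge0 => C _; rewrite diracE lee_fin ler0n.
- exact: cvg_cst.
- apply: cvg_EFin; first exact: nearW.
  rewrite -[X in _ --> X](mulr0 K).
  by apply: cvgM; [exact: cvg_cst|exact: cvg_harmonic].
Qed.
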